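(* Let $(\varphi_n\colon n\in\mathbb{N})$ be a quotient-convergent sequence of increasing submodular setfunctions, each defined on some set-algebra. Then there exists an increasing submodular setfunction $\varphi\colon\mathcal{B}(C)\to\mathbb{R}$, defined on the Borel subsets of the Cantor set $C$, such that $\varphi_n\rightarrowtail\varphi$.
   Context: A set-algebra $(J,\mathcal{B})$ is a family of subsets of $J$ containing $\emptyset$ and closed under complement and finite union. A setfunction on it is a map $\varphi\colon\mathcal{B}\to\mathbb{R}$ with $\varphi(\emptyset)=0$; it is increasing if $X\subseteq Y$ implies $\varphi(X)\le\varphi(Y)$, and submodular if $\varphi(X)+\varphi(Y)\ge\varphi(X\cap Y)+\varphi(X\cup Y)$ for all $X,Y\in\mathcal{B}$. For $k\in\mathbb{N}$ and a map $F\colon J\to[k]$ with $F^{-1}(i)\in\mathcal{B}$ for all $i$, the quotient $\varphi\circ F^{-1}$ is the setfunction $A\mapsto\varphi(F^{-1}(A))$ on $2^{[k]}$, and $Q_k(\varphi)\subseteq\mathbb{R}^{2^k}$ is the set of all such quotients. A sequence $(\varphi_n)$ is quotient-convergent if for every $k$ the sets $Q_k(\varphi_n)$ form a Cauchy sequence in the Hausdorff distance on $\mathbb{R}^{2^k}$; it quotient-converges to $\varphi$, written $\varphi_n\rightarrowtail\varphi$, if for every $k$ the Hausdorff distance between $Q_k(\varphi_n)$ and $Q_k(\varphi)$ tends to $0$. *)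

(* Defs.v *)
From HB Require Import structures.
From mathcomp Require Import all_boot all_order all_algebra.
From mathcomp Require Import all_classical all_reals all_analysis.
Set Implicit Arguments. Unset Strict Implicit. Unset Printing Implicit Defensive.
Import Order.TTheory GRing.Theory Num.Theory.
Local Open Scope classical_set_scope.
Local Open Scope ring_scope.

Section SetFunctions.
Context {R : realType}.

Definition is_setalg {J : Type} (B : set (set J)) : Prop :=
  [/\ B set0, (forall X, B X -> B (~` X)) & (forall X Y, B X -> B Y -> B (X `|` Y))].

(* a setfunction on (J,B): values outside B are irrelevant *)
Definition is_setfun {J : Type} (B : set (set J)) (phi : set J -> R) : Prop :=
  phi set0 = 0.

Definition increasing_sf {J : Type} (B : set (set J)) (phi : set J -> R) : Prop :=
  forall X Y, B X -> B Y -> X `<=` Y -> phi X <= phi Y.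

Definition submodular_sf {J : Type} (B : set (set J)) (phi : set J -> R) : Prop :=
  forall X Y, B X -> B Y -> phi (X `&` Y) + phi (X `|` Y) <= phi X + phi Y.

Definition quot_of {J : Type} (k : nat) (phi : set J -> R) (F : J -> 'I_k)
  : {ffun {set 'I_k} -> R} :=
  [ffun A : {set 'I_k} => phi (F @^-1` [set i | i \in A])].

Definition Qk {J : Type} (k : nat) (B : set (set J)) (phi : set J -> R)
  : set {ffun {set 'I_k} -> R} :=
  [set quot_of phi F | F in [set F : J -> 'I_k | forall i, B (F @^-1` [set i])]].

Definition dist_k (k : nat) (f g : {ffun {set 'I_k} -> R}) : R :=
  \big[Num.max/0]_(A : {set 'I_k}) `|f A - g A|.

Definition hausdorff_dist (k : nat) (X Y : set {ffun {set 'I_k} -> R}) : \bar R :=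
  maxe (ereal_sup [set ereal_inf [set (dist_k x y)%:E | y in Y] | x in X])
       (ereal_sup [set ereal_inf [set (dist_k x y)%:E | x in X] | y in Y]).

Definition quotient_convergent (J : nat -> Type) (B : forall n, set (set (J n)))
  (phi : forall n, set (J n) -> R) : Prop :=
  forall k : nat, (0 < k)%N ->
    forall eps : R, 0 < eps -> exists N : nat, forall m n : nat,
      (N <= m)%N -> (N <= n)%N ->
      (hausdorff_dist (@Qk _ k (B m) (phi m)) (@Qk _ k (B n) (phi n)) < eps%:E)%E.

Definition quotient_converges_to (J : nat -> Type) (B : forall n, set (set (J n)))
  (phi : forall n, set (J n) -> R) (T : Type) (BT : set (set T)) (psi : set T -> R)
  : Prop :=
  forall k : nat, (0 < k)%N ->
    hausdorff_dist (@Qk _ k (B n) (phi n)) (@Qk _ k BT psi) @[n --> \oo] --> 0%E.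

End SetFunctions.

(* Borel subsets of the Cantor set (Cantor space bool^nat, product topology) *)
Definition cantor_borel : set (set cantor_space) := <<s (@open cantor_space) >>.

(* Main.v *)
(** Fix an ultrafilter [U] on the naturals refining the cofinite filter.  Given maps
    [c n : J n -> C] with finite image into the Cantor set such that preimages lie in
    [B n], the [U]-limit [psi] of [phi n (c n @^-1` X)] is defined for every subset [X] of
    [C], and it inherits monotonicity and submodularity.  A partition of [C] pulls back to
    partitions of the [J n], so each quotient of [psi] is a [U]-limit of quotients of the
    [phi n].  For the converse, there are countably many pairs (rational vector, precision);
    for each pair and each [n] choose a partition of [J n] whose quotient is that close to
    the vector, if there is one.  Let the coordinates of [c n] record the first [n] of these
    choices: then each choice is recovered from finitely many coordinates of [C], so a single
    Borel partition of [C] pulls back to it for all large [n]. *)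
Require Import Defs.
From HB Require Import structures.
From mathcomp Require Import all_boot all_order all_algebra.
From mathcomp Require Import all_classical all_reals all_analysis.
From mathcomp Require Import lra.
Import Order.TTheory GRing.Theory Num.Theory.
Import numFieldNormedType.Exports.
Set Implicit Arguments. Unset Strict Implicit. Unset Printing Implicit Defensive.
Local Open Scope classical_set_scope.
Local Open Scope ring_scope.

(** * Set-algebras and measurability of maps with finitely many Boolean coordinates *)

Section SetAlgebra.
Context {J : Type} (B : set (set J)) (algB : is_setalg B).

Lemma setalg_bigcup (I : finType) (P : I -> set J) (Q : set I) :
  (forall i, B (P i)) -> B [set x | exists2 i, Q i & P i x].
Proof.
case: algB => B0 _ BU BP.
have -> : [set x | exists2 i, Q i & P i x] =
  \big[setU/set0]_(i <- enum I) (if `[<Q i>] then P i else set0).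
  rewrite -bigcup_seq; apply/seteqP; split => x /=.
    by case=> i Qi Pi; exists i; rewrite /= ?mem_enum //; case: asboolP.
  by case=> i /= _; case: asboolP => // Qi Pi; exists i.
by elim/big_ind: _ => // i _; case: asboolP.
Qed.

Lemma setalg_bigcap (I : finType) (P : I -> set J) :
  (forall i, B (P i)) -> B [set x | forall i, P i x].
Proof.
move=> BP; case: (algB) => _ BC _.
have -> : [set x | forall i, P i x] =
    ~` [set x | exists2 i, setT i & (~` P i) x].
  apply/seteqP; split => x /= Px; first by case=> i _; apply.
  by move=> i; apply: contrapT => nP; apply: Px; exists i.
by apply/BC; apply: setalg_bigcup => i; exact: BC.
Qed.

(** [S] is finite, and the fibre over each point of [S] is a finite intersection of coordinate sets
    and complements of such sets. *)
Lemma setalg_preimage_ffun (I : finType) (f : J -> {ffun I -> bool}) S :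
  (forall i, B [set x | f x i]) -> B (f @^-1` S).
Proof.
move=> Bf; case: (algB) => _ BC _.
have -> : f @^-1` S = [set x | exists2 g, S g & forall i, f x i = g i].
  apply/seteqP; split => x /=; first by exists (f x).
  by case=> g Sg /ffunP ->.
apply: setalg_bigcup => g; apply: setalg_bigcap => i; case: (g i); first exact: Bf.
have -> : (fun x => f x i = false) = ~` [set x | f x i].
  by apply/seteqP; split => x /=; case: (f x i).
exact: BC.
Qed.

(* Truncating at [m] makes the map finite-valued, so that arbitrary subsets of the Cantor
   space, not only Borel ones, have preimages in the algebra. *)
Definition cantor_code (P : nat -> set J) (m : nat) (x : J) : cantor_space :=
  fun c => (c < m)%N && `[<P c x>].

Lemma setalg_cantor_code P m X :
  (forall c, B (P c)) -> B (cantor_code P m @^-1` X).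
Proof.
move=> BP; pose j x := [ffun c : 'I_m => `[<P c x>]].
pose e (g : {ffun 'I_m -> bool}) : cantor_space :=
  fun c => if insub c is Some i then g i else false.
have -> : cantor_code P m @^-1` X = j @^-1` (e @^-1` X).
  have E x : cantor_code P m x = e (j x).
    apply/funext => c; rewrite /cantor_code /e.
    case: insubP => [i -> <-|/negbTE -> //]; by rewrite ffunE.
  by apply/seteqP; split => x; rewrite /preimage /= E.
apply: setalg_preimage_ffun => i.
suff -> : [set x | j x i] = P i by [].
by apply/seteqP; split => x /=; rewrite ffunE => /asboolP.
Qed.

End SetAlgebra.

Lemma cantor_borel_setalg : is_setalg cantor_borel.
Proof.
have [B0 BC BU] := @smallest_sigma_algebra _ setT (@open cantor_space).
split=> // [X BX|X Y BX BY]; first by rewrite -setTD; apply: BC.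
by rewrite -bigcup2E; apply: BU => -[|[|n]].
Qed.

Lemma cantor_borel_coord c : cantor_borel [set x | x c].
Proof.
apply: sub_sigma_algebra.
suff : open (proj c @^-1` [set true] : set cantor_space).
  by congr (open _); apply/seteqP; split => x /=; rewrite /proj; case: (x c).
apply: open_comp; last exact: discrete_open.
by move=> x _; apply: (@proj_continuous nat (fun=> bool) c).
Qed.

(** * Hausdorff distance between sets of quotients *)

Section Hausdorff.
Context {R : realType} {k : nat}.
Implicit Types (X Y : set {ffun {set 'I_k} -> R}) (f g : {ffun {set 'I_k} -> R}).

Lemma dist_k_ltP f g (e : R) : 0 < e ->
  dist_k f g < e <-> forall A, `|f A - g A| < e.
Proof.
move=> e0; rewrite /dist_k; split=> [fg A|fg].
  by apply: le_lt_trans fg; apply: (le_bigmax_cond _ (fun A => `|f A - g A|)).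
by apply: bigmax_lt.
Qed.

Lemma dist_k_ge0 f g : 0 <= dist_k f g.
Proof. exact: bigmax_ge_id. Qed.

Lemma hausdorff_dist_lt X Y e x : (hausdorff_dist X Y < e%:E)%E -> X x ->
  exists2 y, Y y & dist_k x y < e.
Proof.
rewrite /hausdorff_dist gt_max => /andP[XY _] Xx.
have /ereal_inf_lt[_ [y Yy <-]] :
    (ereal_inf [set (dist_k x y)%:E | y in Y] < e%:E)%E.
  by apply: le_lt_trans XY; apply: ereal_sup_ubound; exists x.
by rewrite lte_fin; exists y.
Qed.

Lemma hausdorff_dist_le X Y e :
  (forall x, X x -> exists2 y, Y y & dist_k x y <= e) ->
  (forall y, Y y -> exists2 x, X x & dist_k x y <= e) ->
  (hausdorff_dist X Y <= e%:E)%E.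
Proof.
move=> XY YX; rewrite /hausdorff_dist ge_max; apply/andP; split.
  apply: ge_ereal_sup => _ [x /XY[y Yy xy] <-].
  apply: (@le_trans _ _ (dist_k x y)%:E); last by rewrite lee_fin.
  by apply: ereal_inf_lbound; exists y.
apply: ge_ereal_sup => _ [y /YX[x Xx xy] <-].
apply: (@le_trans _ _ (dist_k x y)%:E); last by rewrite lee_fin.
by apply: ereal_inf_lbound; exists x.
Qed.

(** Nonemptiness rules out a supremum over the empty set, which would be [-oo]. *)
Lemma hausdorff_dist_ge0 X Y : X !=set0 -> (0 <= hausdorff_dist X Y)%E.
Proof.
case=> x Xx; rewrite /hausdorff_dist le_max; apply/orP; left.
apply: le_trans (ereal_sup_ubound _); last by exists x.
by apply: le_ereal_inf_tmp => _ [y _ <-]; rewrite lee_fin dist_k_ge0.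
Qed.

End Hausdorff.

Lemma Qk_nonempty (R : realType) (J : Type) (B : set (set J)) (phi : set J -> R) k :
  is_setalg B -> Qk (k := k.+1) B phi !=set0.
Proof.
case=> B0 BC _; exists (quot_of phi (fun=> ord0)), (fun=> ord0) => // i.
by rewrite preimage_cst; case: ifP => // _; rewrite -setC0; apply: BC.
Qed.

(** Compactness of the segment yields a cluster point [p]. If the preimage of a neighbourhood [V] of
    [p] were not in [U], that of [~] V[would be, and clustering would make]V[meet]~[V]. *)
Lemma ultrafilter_cvg (R : realType) (T : Type) (U : set_system T) (u : T -> R) a b :
  UltraFilter U -> (\forall n \near U, u n \in `[a, b]) -> cvg (u n @[n --> U]).
Proof.
move=> UU Uab.
have [p [_ clp]] := @segment_compact R a b (u n @[n --> U]) _ Uab.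
apply/cvg_ex; exists p => V pV.
have [//|UV] := in_ultra_setVsetC (u @^-1` V) UU.
by have [q []] := clp (~` V) V UV pV.
Qed.

(** * Limits of pushforwards along a filter *)

Section PushforwardLimit.
Context {R : realType} {J : nat -> Type} {T : Type}.
Unset Implicit Arguments.
Variables (B : forall n, set (set (J n))) (phi : forall n, set (J n) -> R).
Variables (c : forall n, J n -> T) (U : set_system nat) (psi : set T -> R).
Hypothesis Bc : forall n X, B n (c n @^-1` X).
Hypothesis properU : ProperFilter U.
Hypothesis phi_psi : forall X, phi n (c n @^-1` X) @[n --> U] --> psi X.
Set Implicit Arguments.

Lemma limit_setfun : (forall n, is_setfun (B n) (phi n)) -> psi set0 = 0.
Proof.
move=> phi0; apply: (cvg_unique (@Rhausdorff R) (phi_psi set0)).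
have -> : (fun n => phi n (c n @^-1` set0)) = (fun=> 0).
  by apply/funext => n; rewrite preimage_set0; exact: phi0.
exact: cvg_cst.
Qed.

Lemma limit_increasing : (forall n, increasing_sf (B n) (phi n)) ->
  forall X Y, X `<=` Y -> psi X <= psi Y.
Proof.
move=> incr X Y XY; apply: ler_cvg_to (phi_psi X) (phi_psi Y) _.
by apply: nearW => n; apply: incr => //; apply: preimage_subset.
Qed.

Lemma limit_submodular : (forall n, submodular_sf (B n) (phi n)) ->
  forall X Y, psi (X `&` Y) + psi (X `|` Y) <= psi X + psi Y.
Proof.
move=> sub X Y.
apply: ler_cvg_to (cvgD (phi_psi _) (phi_psi _)) (cvgD (phi_psi _) (phi_psi _)) _.
by apply: nearW => n; exact: sub n _ _ (Bc n X) (Bc n Y).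
Qed.

(** A quotient has only finitely many entries, so convergence of [phi n] on each preimage is uniform
    over them. *)
Lemma limit_quot k (F : T -> 'I_k) (e : R) : 0 < e ->
  \forall n \near U, Qk (B n) (phi n) (quot_of (phi n) (F \o c n)) /\
    dist_k (quot_of psi F) (quot_of (phi n) (F \o c n)) < e.
Proof.
move=> e0; pose D (A : {set 'I_k}) := F @^-1` [set i | i \in A].
have : \forall n \near U, forall A, `|psi (D A) - phi n (c n @^-1` D A)| < e.
  by apply: filter_forall => A; exact: (proj1 (cvgrPdist_lt _ _) (phi_psi (D A))).
apply: filterS => n nD; split.
  by exists (F \o c n) => // i; exact: (Bc n (F @^-1` [set i])).
by apply/(dist_k_ltP _ _ e0) => A; rewrite !ffunE; exact: nD.
Qed.

End PushforwardLimit.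

(** This is the case [k = 1]: the only map to ['I_1] is constant, and its quotient records the total
    value [phi n setT]. *)
Lemma quotient_convergent_bounded (R : realType) (J : nat -> Type)
  (B : forall n, set (set (J n))) (phi : forall n, set (J n) -> R) :
  (forall n, is_setalg (B n)) -> quotient_convergent B phi ->
  exists M, \forall n \near \oo, phi n setT <= M.
Proof.
move=> algB /(_ 1%N isT 1 ltr01)[N NP].
exists (phi N setT + 1); exists N => // n /= Nn.
have total m x : Qk (k := 1) (B m) (phi m) x -> x finset.setT = phi m setT.
  case=> F _ <-; rewrite ffunE; congr (phi m).
  by apply/seteqP; split => // y _ /=; rewrite inE.
have [x Qx] := Qk_nonempty (phi n) 0 (algB n).
have [y Qy] := hausdorff_dist_lt (NP n N Nn (leqnn N)) Qx.
move=> /(dist_k_ltP _ _ ltr01)/(_ finset.setT).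
rewrite (total _ _ Qx) (total _ _ Qy) ltr_distl => /andP[_].
exact: ltW.
Qed.

(** * Coding countably many finite partitions by coordinates of the Cantor space *)

Section Coding.
Context {S_ : nat -> countType}.
Local Notation coord := {k : nat & (S_ k * 'I_k.+1)%type}.

Definition coord_index k (s : S_ k) (i : 'I_k.+1) : nat :=
  pickle (Tagged (fun k => (S_ k * 'I_k.+1)%type) (s, i)).

Definition indicator_family {J : Type} (G : forall k, S_ k -> J -> 'I_k.+1) (c : nat)
  : set J :=
  if unpickle c is Some w
  then G (tag (w : coord)) (tagged w).1 @^-1` [set (tagged w).2] else set0.

(** In a long enough code exactly one coordinate belonging to [s] is true; the default [ord0] covers
    points of the Cantor space where none is. *)
Definition decode k (s : S_ k) (z : cantor_space) : 'I_k.+1 :=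
  odflt ord0 [pick i | z (coord_index s i)].

Lemma indicator_family_coord {J : Type} (G : forall k, S_ k -> J -> 'I_k.+1) k
  (s : S_ k) i : indicator_family G (coord_index s i) = G k s @^-1` [set i].
Proof. by rewrite /indicator_family /coord_index pickleK. Qed.

Lemma decode_code {J : Type} (G : forall k, S_ k -> J -> 'I_k.+1) k (s : S_ k) m x :
  (forall i, (coord_index s i < m)%N) ->
  decode s (cantor_code (indicator_family G) m x) = G k s x.
Proof.
move=> sm; have E i : cantor_code (indicator_family G) m x (coord_index s i) =
    (G k s x == i).
  rewrite /cantor_code sm /= indicator_family_coord.
  by apply/asboolP/eqP.
rewrite /decode; case: pickP => [i|/(_ (G k s x))]; rewrite E ?eqxx //.
by move/eqP.
Qed.

(** [decode s] depends on only the finitely many coordinates [coord_index s j]. *)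
Lemma decode_borel k (s : S_ k) i : cantor_borel (decode s @^-1` [set i]).
Proof.
pose f (z : cantor_space) := [ffun j => z (coord_index s j)].
have -> : decode s @^-1` [set i] =
    f @^-1` [set g : {ffun 'I_k.+1 -> bool} | odflt ord0 [pick j | g j] = i].
  apply/seteqP; split => z /=; rewrite /decode => <-; congr odflt;
    by apply: eq_pick => j; rewrite ffunE.
apply: (setalg_preimage_ffun cantor_borel_setalg) => j.
have := cantor_borel_coord (coord_index s j).
by congr cantor_borel; apply/seteqP; split => z /=; rewrite ffunE.
Qed.

End Coding.

(** * Rational targets and the partitions chosen for them *)

Definition rational_target (k : nat) : countType :=
  ({ffun {set 'I_k.+1} -> rat} * nat)%type.

(* A target [s = (v, p)] stands for the open ball of radius [1/(p+1)] around [v]. *)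
Definition near_target {R : realType} k (s : rational_target k)
  (y : {ffun {set 'I_k.+1} -> R}) : Prop :=
  forall A, `|ratr (s.1 A) - y A| < s.2.+1%:R^-1.

(** The conditional form makes the choice total in [s]: if no quotient meets the ball, a constant
    map serves. *)
Lemma near_target_map (R : realType) (J : Type) (B : set (set J)) (phi : set J -> R)
  k (s : rational_target k) : is_setalg B ->
  exists F : J -> 'I_k.+1, (forall i, B (F @^-1` [set i])) /\
    ((exists2 y, Qk B phi y & near_target s y) -> near_target s (quot_of phi F)).
Proof.
move=> algB.
have [[_ [F BF <-] sF]|nS] := pselect (exists2 y, Qk B phi y & near_target s y).
  by exists F.
by have [_ [F BF _]] := Qk_nonempty phi k algB; exists F.
Qed.

Lemma rational_vector_dense (R : realType) k (x : {ffun {set 'I_k.+1} -> R}) (d : R) :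
  0 < d -> exists v : {ffun {set 'I_k.+1} -> rat}, forall A, `|ratr (v A) - x A| < d.
Proof.
move=> d0.
have /choice[v vP] : forall A, exists q : rat, `|ratr q - x A| < d.
  move=> A; have /rat_in_itvoo[q] : x A - d < x A + d by rewrite ltrBlDr -addrA ltrDl addr_gt0.
  by rewrite in_itv /= -ltr_distl; exists q.
by exists [ffun A => v A] => A; rewrite ffunE.
Qed.

Theorem theorem3p1 (R : realType) (J : nat -> Type)
  (B : forall n, set (set (J n))) (phi : forall n, set (J n) -> R) :
  (forall n, is_setalg (B n)) ->
  (forall n, is_setfun (B n) (phi n)) ->
  (forall n, increasing_sf (B n) (phi n)) ->
  (forall n, submodular_sf (B n) (phi n)) ->
  quotient_convergent B phi ->
  exists psi : set cantor_space -> R,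
    [/\ is_setfun cantor_borel psi, increasing_sf cantor_borel psi,
        submodular_sf cantor_borel psi &
        quotient_converges_to B phi cantor_borel psi].
Proof.
move=> algB phi0 incr submod conv.
pose G m k (s : rational_target k) := sval (cid (near_target_map (phi m) s (algB m))).
have GP m k (s : rational_target k) := svalP (cid (near_target_map (phi m) s (algB m))).
pose c m := cantor_code (indicator_family (G m)) m.
have Bc m X : B m (c m @^-1` X).
  apply: setalg_cantor_code => // j; rewrite /indicator_family.
  by case: unpickle => [w|]; [apply: (GP m _ _).1|case: (algB m)].
have [M phiM] := quotient_convergent_bounded algB conv.
have [U [UU oU]] := ultraFilterLemma (@eventually_filter).
pose psi X := lim (phi m (c m @^-1` X) @[m --> U]).
have psiP X : phi m (c m @^-1` X) @[m --> U] --> psi X.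
  (* Monotonicity traps the values between [phi m set0 = 0] and [phi m setT], which is eventually at
     most [M]. *)
  apply: (@ultrafilter_cvg _ _ _ _ 0 M); apply: oU; apply: filterS phiM => m mM.
  have [B0 BC _] := algB m; have BT : B m setT by rewrite -setC0; apply: BC.
  rewrite in_itv /= -{1}(phi0 m) (le_trans _ mM) ?andbT; first exact: incr.
  by rewrite incr.
exists psi; split.
- exact: (limit_setfun _ psiP phi0).
- by move=> X Y _ _; exact: (limit_increasing Bc _ psiP incr).
- by move=> X Y _ _; exact: (limit_submodular Bc _ psiP submod).
case=> // k _.
have close e : 0 < e -> \forall n \near \oo,
  (hausdorff_dist (Qk (k := k.+1) (B n) (phi n)) (Qk cantor_borel psi) <= e%:E)%E.
  move=> e0.
  have [p pe] : exists p : nat, p.+1%:R^-1 < e / 2.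
    have e20 : 0 < e / 2 by rewrite divr_gt0.
    by have /filter_ex[p] := near_infty_natSinv_lt (PosNum e20); exists p.
  (* The target radius is [2d]. From the quotient of [psi] to that of [phi m], then to [v], then to
     [x] costs [d + 2d + d = 4d < e]. *)
  pose d : R := p.+1%:R^-1 / 2.
  have d0 : 0 < d by rewrite divr_gt0 // invr_gt0 ltr0n.
  have [N NP] := conv k.+1 isT d d0.
  exists N => // n /= Nn; apply: hausdorff_dist_le.
    move=> x Qx; have [v vx] := rational_vector_dense x d0.
    pose s : rational_target k := (v, p).
    exists (quot_of psi (decode s)); first by exists (decode s) => // i; exact: decode_borel.
    (* One stage [m] must be close to the limit, past [N], and late enough for its code to contain
       every coordinate of [s]. *)
    have /filter_ex[m [[Qm sm] [Nm cm]]] : \forall m \near U,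
      (Qk (B m) (phi m) (quot_of (phi m) (decode s \o c m)) /\
      dist_k (quot_of psi (decode s)) (quot_of (phi m) (decode s \o c m)) < d) /\
      ((N <= m)%N /\ forall i, (coord_index s i < m)%N).
      apply: filterI; first exact: (limit_quot Bc _ psiP _ d0).
      apply: oU; apply: filterI; first exact: nbhs_infty_ge.
      apply: (@filter_forall _ _ (fun i m => (coord_index s i < m)%N) \oo) => i.
      exact: nbhs_infty_gt.
    have [y Qy xy] := hausdorff_dist_lt (NP n m Nn Nm) Qx.
    (* Some quotient [y] of [phi m] is within [d] of [x], hence within [2d] of [v]; so the map
       chosen for [s] at stage [m] also hits the ball. *)
    have /(GP m k s).2 Gs : exists2 y, Qk (B m) (phi m) y & near_target s y.
      exists y => // A; rewrite /= (splitr p.+1%:R^-1) -/d.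
      by rewrite (le_lt_trans (ler_distD (x A) _ _)) // ltrD // (dist_k_ltP _ _ d0).1.
    have E : decode s \o c m = G m k s.
      by apply/funext => z; exact: decode_code.
    rewrite E in sm.
    have e2 : p.+1%:R^-1 = d + d by rewrite -splitr.
    apply/ltW/(dist_k_ltP _ _ e0) => A.
    have := Gs A; have := (dist_k_ltP _ _ d0).1 sm A; have := vx A.
    move: pe; rewrite /= -/(G m k s) e2 !ltr_distl !ffunE.
    by move=> ? /andP[? ?] /andP[? ?] /andP[? ?]; apply/andP; split; lra.
  (* Conversely, [F] pulls back along [c m] to a quotient of [phi m], which is [d]-close to that of
     [psi] and to some quotient of [phi n]; here [2d < e]. *)
  move=> _ [F BF <-].
  have /filter_ex[m [[Qm sm] Nm]] : \forall m \near U,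
      (Qk (B m) (phi m) (quot_of (phi m) (F \o c m)) /\
      dist_k (quot_of psi F) (quot_of (phi m) (F \o c m)) < d) /\ (N <= m)%N.
    apply: filterI; first exact: (limit_quot Bc _ psiP _ d0).
    by apply: oU; exact: nbhs_infty_ge.
  have [x Qx xm] := hausdorff_dist_lt (NP m n Nm Nn) Qm.
  exists x => //; apply/ltW/(dist_k_ltP _ _ e0) => A.
  have := (dist_k_ltP _ _ d0).1 sm A; have := (dist_k_ltP _ _ d0).1 xm A.
  have : d < e / 2 by apply: le_lt_trans pe; rewrite ler_pdivrMr // ler_peMr ?invr_ge0 // ler1n.
  rewrite !ltr_distl => ? /andP[? ?] /andP[? ?]; apply/andP; split; lra.
have ge0 n := hausdorff_dist_ge0 (Qk cantor_borel psi) (Qk_nonempty (phi n) k (algB n)).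
(* The bound [close 1] makes the distances eventually finite, so convergence can be checked in
   [R]. *)
apply/fine_cvgP; split.
  apply: filterS (close 1 ltr01) => n le1.
  by rewrite ge0_fin_numE // (le_lt_trans le1) // ltry.
apply/cvgrPdist_le => e e0; apply: filterS (close e e0) => n le_e.
rewrite sub0r normrN ger0_norm ?fine_ge0 //= -lee_fin fineK //.
by rewrite ge0_fin_numE // (le_lt_trans le_e) // ltry.
Qed.
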